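(* Let $r\ge3$ be an integer and for integers $n$ let $P_n=\dfrac{n\left(n(r-2)-(r-4)\right)}{2}$ (the $r$-gonal numbers). For integers $n\ge1$, $k\ge1$ and $m\ge3$, the $m$-sided polygon with vertices, in order, $(P_{n+2ik},P_{n+(2i+1)k})$ for $i=0,1,\dots,m-1$ has area $$\frac{4m(m-1)(m-2)(r-2)^2k^4}{6}.$$
   Context: The area of a polygon with vertices $(x_1,y_1),\dots,(x_m,y_m)$ taken in this order is given by the shoelace formula $\frac12\left|\sum_{i=1}^{m}(x_iy_{i+1}-x_{i+1}y_i)\right|$, indices taken mod $m$. *)

(* Defs.v *)
From mathcomp Require Import all_boot all_order all_algebra.

Set Implicit Arguments.
Unset Strict Implicit.
Unset Printing Implicit Defensive.

Import Order.TTheory GRing.Theory Num.Theory.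
Local Open Scope ring_scope.

(* The [n]-th [r]-gonal number, for an arbitrary integer index [n]. *)
Definition polygonal_number (R : realFieldType) (r n : int) : R :=
  (n * (n * (r - 2) - (r - 4)))%:~R / 2.

(* Shoelace formula; [ordS i] is [i + 1] modulo [m], so the last term joins
   the last vertex to the first one. *)
Definition polygon_area (R : realFieldType) (m : nat) (v : 'I_m -> R * R) : R :=
  2^-1 * `| \sum_(i < m) ((v i).1 * (v (ordS i)).2
                          - (v (ordS i)).1 * (v i).2) |.

(* Main.v *)
Require Import Defs.
From mathcomp Require Import all_boot all_order all_algebra.
From mathcomp Require Import ring.

Set Implicit Arguments.
Unset Strict Implicit.
Unset Printing Implicit Defensive.

Import Order.TTheory GRing.Theory Num.Theory.
Local Open Scope ring_scope.

(** With [p t] the [n + t k]-th polygonal number, a quadratic in [t] with leading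
    coefficient [a = (r - 2) k ^ 2 / 2], the vertices are [(p (2 i), p (2 i + 1))].
    Up to an affine map of determinant [1] they are [(4 a i ^ 2, 4 a i)], so the
    signed area depends on [a] and [m] only; closing the polygon after each
    number of vertices gives the value by induction. *)

(** The index wraps around only at [M]; splitting off that closing edge leaves an open chain that
    can grow by induction. *)
Lemma sum_ordS (R : pzRingType) (M : nat) (F : nat -> nat -> R) :
  \sum_(i < M.+1) F i (ordS i) = \sum_(i < M) F i i.+1 + F M 0%N.
Proof.
rewrite big_ord_recr /= modnn; congr (_ + _).
by apply: eq_bigr => i _; rewrite modn_small // ltnS.
Qed.

Section QuadraticPolygon.
Variables (R : realFieldType) (a b c : R).

Let p (t : R) : R := a * t ^+ 2 + b * t + c.
Let cross (i j : nat) : R :=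
  p (2 * i%:R) * p (2 * j%:R + 1) - p (2 * j%:R) * p (2 * i%:R + 1).

(** Vertices [0] to [M] are closed up by [cross M 0]. Adding vertex [M + 1] glues on the triangle
    [0, M, M + 1], whose doubled signed area is [- 16 a ^ 2 M (M + 1)]; the closed form is the sum
    of these. *)
Lemma shoelace_quadratic (M : nat) :
  \sum_(i < M) cross i i.+1 + cross M 0%N =
  - (16 * a ^+ 2 * (M%:R + 1) * M%:R * (M%:R - 1) / 3).
Proof.
elim: M => [|M IH]; first by rewrite big_ord0 /cross; ring.
rewrite big_ord_recr /=.
move/(canRL (addrK _)): IH => ->.
by rewrite /cross /p -!natr1; field.
Qed.

Lemma polygon_area_quadratic (m : nat) : (2 <= m)%N ->
  polygon_area (fun i : 'I_m => (p (2 * i%:R), p (2 * i%:R + 1))) =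
  8 * a ^+ 2 * m%:R * (m%:R - 1) * (m%:R - 2) / 3.
Proof.
case: m => [//|[//|M]] _; rewrite /polygon_area /= (sum_ordS _ cross).
rewrite shoelace_quadratic normrN ger0_norm; last first.
  (* Here [m = M + 2]; rewriting the factor [M.+1 - 1] as [M] makes every factor visibly
     nonnegative. *)
  rewrite -[M.+1%:R]natr1 addrK.
  by rewrite !(sqr_ge0, mulr_ge0, addr_ge0, invr_ge0, ler0n, ler01).
by rewrite -!natr1; field.
Qed.

End QuadraticPolygon.

Lemma polygonal_number_quadratic (R : realFieldType) (r n k t : int) :
  polygonal_number R r (n + t * k) =
  (r%:~R - 2) * k%:~R ^+ 2 / 2 * t%:~R ^+ 2
  + (2 * n%:~R * (r%:~R - 2) - (r%:~R - 4)) * k%:~R / 2 * t%:~R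
  + polygonal_number R r n.
Proof. by rewrite /polygonal_number !(rmorphB, rmorphD, rmorphM) /=; field. Qed.

Theorem theorem5p1 (R : realFieldType) (r n k : int) (m : nat)
    (hr : 3 <= r) (hn : 1 <= n) (hk : 1 <= k) (hm : (3 <= m)%N) :
  polygon_area (fun i : 'I_m =>
    (polygonal_number R r (n + 2 * i%:Z * k),
     polygonal_number R r (n + (2 * i%:Z + 1) * k)))
  = 4 * m%:R * (m%:R - 1) * (m%:R - 2) * (r%:~R - 2) ^+ 2 * k%:~R ^+ 4 / 6.
Proof.
set a : R := (r%:~R - 2) * k%:~R ^+ 2 / 2.
transitivity (8 * a ^+ 2 * m%:R * (m%:R - 1) * (m%:R - 2) / 3); last first.
  by rewrite /a; field.
(* The area does not mention the two lower coefficients, so they are supplied from the expansion of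
   the [n + t k]-th polygonal number in [t]. *)
rewrite -(polygon_area_quadratic a
  ((2 * n%:~R * (r%:~R - 2) - (r%:~R - 4)) * k%:~R / 2)
  (polygonal_number R r n) (ltnW hm)).
rewrite /polygon_area; congr (_ * `| _ |); apply: eq_bigr => i _.
by rewrite /= !polygonal_number_quadratic !rmorphD !rmorphM /= -!pmulrn.
Qed.
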